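(* Let $T_n:\mathbb{C}\times S^1\to\mathbb{C}$, $n\ge 1$, be maps such that, writing $T_{n,\theta}(z):=T_n(z,e^{i\theta})$, the map $T_{n,\theta}-\mathrm{Id}:\mathbb{C}\to\mathbb{C}$ has Lipschitz constant $\mathrm{Lip}(T_{n,\theta}-\mathrm{Id})<4^{-n}$ for all $n$ and all $\theta$. Then $(T_n)$ is an undercooking of the plane: there is a constant $C>0$ independent of $n$ such that $\mathrm{Fav}_{T_n}(\mathcal{K}_n)\ge C\frac{\log n}{n}$ for all $n\ge 2$.
   Context: Middle-half Cantor set: $\mathcal{C}_0=[0,1]$ and $\mathcal{C}_{n+1}$ is obtained from $\mathcal{C}_n$ by replacing each of its intervals by the first and last quarters of that interval. Thus $\mathcal{C}_n$ is a union of $2^n$ intervals of length $4^{-n}$ and $\mathcal{K}_n:=\mathcal{C}_n\times\mathcal{C}_n\subset\mathbb{C}$ is a union of $4^n$ squares of side $4^{-n}$. $\mathrm{Proj}_\theta$ is orthogonal projection onto the line through the origin in direction $e^{i\theta}$, $|\cdot|$ is one-dimensional Lebesgue measure. For $T:\mathbb{C}\times S^1\to\mathbb{C}$, $T_\theta(z):=T(z,e^{i\theta})$ and $\mathrm{Fav}_T(E):=\frac{1}{2\pi}\int_0^{2\pi}|\mathrm{Proj}_\theta(T_\theta(E))|\,d\theta$. *)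

(* Defs.v *)
(* The complex plane C is modelled as R * R. *)
From HB Require Import structures.
From mathcomp Require Import all_boot all_order all_algebra.
From mathcomp Require Import all_classical all_reals all_analysis.
Set Implicit Arguments. Unset Strict Implicit. Unset Printing Implicit Defensive.
Import Order.TTheory GRing.Theory Num.Theory.
Local Open Scope classical_set_scope.
Local Open Scope ring_scope.

Section Defs.
Variable R : realType.

Definition pt := (R * R)%type.

Definition dist2 (z w : pt) : R :=
  Num.sqrt ((z.1 - w.1) ^+ 2 + (z.2 - w.2) ^+ 2).

Definition lip_lt (f : pt -> pt) (c : R) : Prop :=
  exists L : R, L < c /\ forall z w, dist2 (f z) (f w) <= L * dist2 z w.

Definition minus_id (f : pt -> pt) : pt -> pt :=
  fun z => ((f z).1 - z.1, (f z).2 - z.2).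

Definition expi (theta : R) : pt := (cos theta, sin theta).

(* T_theta(z) := T(z, e^{i theta}); T : C x S^1 -> C is modelled as
   C -> C -> C, only its values on the unit circle in the 2nd argument matter *)
Definition Tth (T : pt -> pt -> pt) (theta : R) : pt -> pt :=
  fun z => T z (expi theta).

(* left endpoints of the 2^n intervals of C_n (each of length 4^-n):
   each interval [a, a + 4^-n] is replaced by its first and last quarters
   [a, a + 4^-(n+1)] and [a + 3*4^-(n+1), a + 4^-n]. *)
Fixpoint cantor_lefts (n : nat) : seq R :=
  match n with
  | O => [:: 0]
  | m.+1 => flatten [seq [:: a; a + 3 * (4 ^- m.+1)] | a <- cantor_lefts m]
  end.

Definition cantorC (n : nat) : set R :=
  [set x | exists a, a \in cantor_lefts n /\ a <= x <= a + 4 ^- n].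

Definition cantorK (n : nat) : set pt :=
  [set z | cantorC n z.1 /\ cantorC n z.2].

(* Proj_theta(E), identified with a subset of R via the coordinate along
   the unit vector e^{i theta} *)
Definition proj (theta : R) (E : set pt) : set R :=
  [set t | exists2 z, E z & t = z.1 * cos theta + z.2 * sin theta].

Definition Fav (T : pt -> pt -> pt) (E : set pt) : \bar R :=
  ((2 * pi)^-1)%:E *
  (\int[lebesgue_measure]_(theta in `[0%R, (2 * pi)%R]%classic)
      lebesgue_measure (proj theta (Tth T theta @` E)))%E.

End Defs.

(* Main.v *)
(** The argument is a second-moment estimate localised near the direction theta0
    with tan theta0 = 1/2.  The 4^n squares are indexed by m < 4^n through base-4
    digits so that the corner of square m is 3 * 4^-n * (x, y) with 2 x + y = m:
    in the direction theta0 the squares project onto consecutive intervals.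
    For directions at distance about 2^-j from theta0, two squares that first
    separate at scale 4^k have overlapping projections only if their indices lie
    within O(4^k / 2^j) of a common multiple of 4^k, and then only for a set of
    directions of measure O(4^-k).  Hence the pairs that overlap, integrated over
    this window of directions, amount to O(n 4^n 4^-j) as long as 2^j <= n, and
    Cauchy-Schwarz bounds the integral of the projected length over the window
    below by c / n.  There are about log n windows.  A perturbation with
    Lip(T - Id) < 4^-n moves the projections of the squares, relative to each
    other, by O(4^-n), which only changes the notion of overlap by a constant. *)
Require Import Defs.
From HB Require Import structures.
From mathcomp Require Import all_boot all_order all_algebra.
From mathcomp Require Import all_classical all_reals all_analysis.
From mathcomp Require Import measurable_realfun zify ring lra.
Set Implicit Arguments. Unset Strict Implicit. Unset Printing Implicit Defensive.
Import Order.TTheory GRing.Theory Num.Theory.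
Import numFieldNormedType.Exports.

(** * Base-4 indexing of the squares *)

(** Replaces each of the [n] lowest base-4 digits of [m] by its image 0 or 1 under [f], read again
    in base 4. Scaled by [3 * 4^-n] this is a left endpoint of a Cantor interval, a digit 1
    selecting the last quarter. *)
Fixpoint spread (f : nat -> bool) (n m : nat) : nat :=
  if n is n'.+1 then 4 * spread f n' (m %/ 4) + f (m %% 4) else 0.

(** A digit [d < 4] is [2 * (2 <= d) + odd d]: its high bit selects the column and its low bit the
    row. *)
Definition xidx := spread (leq 2).
Definition yidx := spread odd.

Lemma xidx_yidx n m : m < 4 ^ n -> 2 * xidx n m + yidx n m = m.
Proof.
elim: n m => [|n IHn] m; first by rewrite expn0; case: m.
rewrite expnS => mlt; have {IHn} := IHn (m %/ 4).
rewrite ltn_divLR// mulnC => /(_ mlt); rewrite /xidx /yidx /=.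
have := divn_eq m 4; have := ltn_pmod m (isT : 0 < 4).
by case: (m %% 4) => [|[|[|[|]]]] //=; lia.
Qed.

(** The [i] low digits contribute at most [1 + 4 + ... + 4^(i-1)], which is less than [4^i / 3]; the
    factor 3 avoids the division. *)
Lemma spread_block f n i m :
  4 ^ i * spread f n (m %/ 4 ^ i) <= spread f (n + i) m /\
  3 * spread f (n + i) m < 3 * (4 ^ i * spread f n (m %/ 4 ^ i)) + 4 ^ i.
Proof.
elim: i m => [|i IHi] m; first by rewrite expn0 divn1 addn0 mul1n; lia.
rewrite addnS expnS divnMA /=.
have [] := IHi (m %/ 4); move: (4 ^ i) (spread f n _) => q s.
by move: (spread _ _ _) (f _) => u [] /=; nia.
Qed.

Lemma spread_same_block f n i m m' : i <= n -> m %/ 4 ^ i = m' %/ 4 ^ i ->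
  3 * spread f n m < 3 * spread f n m' + 4 ^ i.
Proof.
move=> /subnK <- e.
have [_ h1] := spread_block f (n - i) i m.
have [h2 _] := spread_block f (n - i) i m'.
by move: h1 h2; rewrite e; lia.
Qed.

(** Digit [k] gains [4^k], and the lower digits give back less than a third of it. *)
Lemma spread_diff_digit f n k m m' : k < n ->
  m %/ 4 ^ k.+1 = m' %/ 4 ^ k.+1 ->
  ~~ f (m %/ 4 ^ k %% 4) -> f (m' %/ 4 ^ k %% 4) ->
  3 * spread f n m + 2 * 4 ^ k < 3 * spread f n m'.
Proof.
move=> kn; have -> : n = (n - k.+1).+1 + k by lia.
rewrite expnSr !divnMA => e f0 f1.
have [_] := spread_block f (n - k.+1).+1 k m.
have [+ _] := spread_block f (n - k.+1).+1 k m'.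
move: (spread f (_ + k) m) (spread f (_ + k) m') => u u'.
rewrite /= e f1 (negbTE f0).
by move: (4 ^ k) (spread f _ _) => ??; nia.
Qed.

(** [k] is the highest position at which the base-4 digits differ: [k + 1] is the least [i] whose
    quotients by [4^i] agree. *)
Lemma separation_level n m m' : m != m' -> m < 4 ^ n -> m' < 4 ^ n ->
  exists k, [/\ k < n, m %/ 4 ^ k.+1 = m' %/ 4 ^ k.+1 &
    m %/ 4 ^ k != m' %/ 4 ^ k].
Proof.
move=> neq mlt mlt'.
have ex : exists i, m %/ 4 ^ i == m' %/ 4 ^ i by exists n; rewrite !divn_small.
case: (ex_minnP ex) => -[|k] /eqP e min.
  by move: e neq; rewrite expn0 !divn1 => ->; rewrite eqxx.
exists k; split=> //.
  by apply: min; rewrite !divn_small.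
by apply/negP => /min; rewrite ltnn.
Qed.

Lemma xidx_or_yidx_apart n k m m' : k < n ->
  m %/ 4 ^ k.+1 = m' %/ 4 ^ k.+1 -> m %/ 4 ^ k != m' %/ 4 ^ k ->
  exists f, (f = leq 2 \/ f = odd) /\
  (3 * spread f n m + 2 * 4 ^ k < 3 * spread f n m' \/
   3 * spread f n m' + 2 * 4 ^ k < 3 * spread f n m).
Proof.
move=> kn e ne.
set d := m %/ 4 ^ k %% 4; set d' := m' %/ 4 ^ k %% 4.
have dd : d != d'.
  apply: contra ne => /eqP dd; rewrite (divn_eq (m %/ 4 ^ k) 4).
  rewrite [X in _ == X](divn_eq (m' %/ 4 ^ k) 4).
  by rewrite -!divnMA -!expnSr e -/d dd.
have [f [fE fdd]] : exists f, (f = leq 2 \/ f = odd) /\ f d != f d'.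
  have : d < 4 by rewrite ltn_pmod.
  have : d' < 4 by rewrite ltn_pmod.
  case: d dd => [|[|[|[|]]]] //; case: d' => [|[|[|[|]]]] // _ _ _;
    by [exists odd; split; [right|] | exists (leq 2); split; [left|]].
exists f; split=> //.
have [f1|f1] := boolP (f d').
  left; apply: spread_diff_digit => //; move: fdd; rewrite -/d f1.
  by case: (f d).
right; apply: spread_diff_digit => //; move: fdd; rewrite -/d (negbTE f1).
by case: (f d).
Qed.

(** * Counting pairs of indices that straddle a block boundary *)

Lemma sum_interval_le M a b : \sum_(i < M) (a <= i < b) <= b - a.
Proof.
suff -> : \sum_(i < M) (a <= i < b) = minn M b - a by lia.
by elim: M => [|M IHM]; rewrite ?big_ord0 ?big_ord_recr /= ?IHM; lia.
Qed.

Definition crosses (q r m m' : nat) : bool :=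
  [&& m < m', m' <= m + r & m %/ q != m' %/ q].

Lemma crosses_mod q r m m' : 0 < q -> crosses q r m m' -> q - r <= m %% q < q.
Proof.
move=> q0 /and3P[mm mr ne]; rewrite ltn_pmod// andbT.
have mq := divn_eq m q; have mq' := divn_eq m' q.
have h : m %/ q < m' %/ q by rewrite ltn_neqAle ne leq_div2r// ltnW.
have := ltn_pmod m q0.
move: (m %% q) (m' %% q) (m %/ q) (m' %/ q) mq mq' h => x x' y y'; nia.
Qed.

(** In each of the [t] blocks of length [q], only the last [r] indices can reach the next block by a
    step of at most [r], and each has at most [r] partners. *)
Lemma sum_crosses_le q r t : 0 < q ->
  \sum_(m < t * q) \sum_(m' < t * q) crosses q r m m' <= t * r * r.
Proof.
move=> q0.
apply: (@leq_trans (\sum_(m < t * q) (q - r <= m %% q < q) * r)).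
  apply: leq_sum => m _; case: (boolP (q - r <= m %% q < q)) => [_|h]; last first.
    rewrite big1 // => m' _; case: (boolP (crosses _ _ _ _)) => //.
    by move/(crosses_mod q0); rewrite (negbTE h).
  rewrite mul1n; apply: (@leq_trans (\sum_(m' < t * q) (m.+1 <= m' < (m + r).+1))).
    by apply: leq_sum => m' _; rewrite /crosses ltnS; case: (_ != _); rewrite ?andbT ?andbF ?leq0n.
  by apply: leq_trans (sum_interval_le _ _ _) _; lia.
rewrite -big_distrl leq_mul2r /=; apply/orP; right.
elim: t => [|t IHt]; first by rewrite mul0n big_ord0.
rewrite mulSn addnC big_split_ord /= mulSn addnC leq_add//.
under eq_bigr do rewrite modnMDl modn_small//.
by apply: leq_trans (sum_interval_le _ _ _) _; lia.
Qed.

Local Open Scope classical_set_scope.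
Local Open Scope ring_scope.

(** * Trigonometry near the exceptional direction *)

Section Trig.
Context {R : realType}.
Implicit Types x t : R.

Lemma sin_mvt x : 0 <= x -> exists2 c, 0 <= c <= x & sin x = cos c * x.
Proof.
move=> x0.
have [|c cx e] := @MVT_segment R sin cos 0 x x0 (fun y _ => is_derive_sin y).
  by apply: continuous_subspaceT => y; exact: continuous_sin.
exists c; first by move: cx; rewrite in_itv.
by move: e; rewrite sin0 !subr0.
Qed.

Lemma sin_le_id x : 0 <= x -> sin x <= x.
Proof.
move=> x0; have [c _ ->] := sin_mvt x0.
by have := cos_le1 c; nra.
Qed.

Lemma cos_ge_quadratic x : 0 <= x <= 1 -> 1 - x ^+ 2 / 2 <= cos x.
Proof.
move=> /andP[x0 x1].
have s0 : 0 <= sin (x / 2) by apply: sin_ge0_pi; have := @pi_ge2 R; lra.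
have sx : sin (x / 2) <= x / 2 by apply: sin_le_id; lra.
have -> : cos x = 1 - 2 * sin (x / 2) ^+ 2.
  have -> : cos x = cos ((x / 2) *+ 2) by congr cos; rewrite mulr2n; lra.
  by rewrite cos_mulr2n cos2sin2 mulr2n; ring.
nra.
Qed.

Lemma norm_sin_ge_half x : `|x| <= 1 -> `|x| / 2 <= `|sin x|.
Proof.
move=> x1; wlog x0 : x x1 / 0 <= x.
  move=> H; have [/H-> //|xN] := leP 0 x.
  by rewrite -normrN -[X in _ <= X]normrN -sinN H ?normrN//; lra.
rewrite ger0_norm// in x1 *.
have [c /andP[c0 cx] ->] := sin_mvt x0.
have : 1 - c ^+ 2 / 2 <= cos c by apply: cos_ge_quadratic; lra.
move=> hc; have hc' : 1 / 2 <= cos c by nra.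
rewrite ger0_norm; nra.
Qed.

Definition theta0 : R := atan (1 / 2).

(** The exact values are [2 / sqrt 5] and [1 / sqrt 5]; rational bounds suffice below. *)
Lemma theta0_trig : [/\ cos theta0 = 2 * sin theta0,
  2 / 5 <= sin theta0 & sin theta0 <= 1 / 2].
Proof.
have c0 : 0 < cos theta0.
  by apply: cos_gt0_pihalf; rewrite atan_gtNpi2 atan_ltpi2.
have e : cos theta0 = 2 * sin theta0.
  have := @atanK R (1 / 2); rewrite /tan -/theta0 => /(congr1 ( *%R^~ (cos theta0))).
  by rewrite mulfVK ?gt_eqF//; lra.
have := cos2Dsin2 theta0; rewrite e => sq.
have s0 : 0 < sin theta0 by move: c0; rewrite e; lra.
split=> //; nra.
Qed.

Lemma theta0_itv : 0 < theta0 < pi / 2.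
Proof.
rewrite atan_ltpi2 andbT ltNge; apply/negP => h.
have [_ + _] := theta0_trig; have : sin (- theta0) >= 0.
  by apply: sin_ge0_pi; have := @atan_gtNpi2 R (1 / 2); rewrite -/theta0;
     have := @pi_gt0 R; lra.
by rewrite sinN; lra.
Qed.

Lemma near_theta0 t : 0 <= t <= 1 / 4 ->
  [/\ 9 / 16 <= cos (theta0 + t), 1 / 4 <= sin (theta0 + t) &
      `|cos (theta0 + t) - 2 * sin (theta0 + t)| <= 4 * t].
Proof.
move=> /andP[t0 t1]; have [e s1 s2] := theta0_trig.
rewrite cosD sinD e.
have ht : sin t <= t by exact: sin_le_id.
have hs0 : 0 <= sin t by apply: sin_ge0_pi; have := @pi_ge2 R; lra.
have hc : 1 - t ^+ 2 / 2 <= cos t by apply: cos_ge_quadratic; lra.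
have hc' : 31 / 32 <= cos t by nra.
split; [nra|nra|].
(* The combination vanishes at [theta0], so only a multiple of [sin t] survives. *)
rewrite (_ : _ - _ = - (5 * sin theta0 * sin t)); last by ring.
rewrite normrN ger0_norm; nra.
Qed.

End Trig.

(** * Pairs of squares with overlapping projections *)

Section Pairs.
Context {R : realType}.
Implicit Types t : R.
Local Notation mu := (@lebesgue_measure R).

Definition dx n m m' : R := (xidx n m')%:R - (xidx n m)%:R.
Definition dy n m m' : R := (yidx n m')%:R - (yidx n m)%:R.

(** Corners differ by [3 * 4^-n * (dx, dy)], so the threshold 1 means that the unperturbed corners
    project within [3 * 4^-n] of each other. *)
Definition close_at n m m' : set R :=
  [set t | `|dx n m m' * cos t + dy n m m' * sin t| <= 1].

(** Half-open dyadic pieces are pairwise disjoint; the factor 1/4 keeps them in the range of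
    [near_theta0] and turns its bound [4 * t] into [2^-j]. *)
Definition window (j : nat) : set R :=
  `]theta0 + 2 ^- j.+1 / 4, theta0 + 2 ^- j / 4]%classic.

Lemma exp2N_gt0 (j : nat) : 0 < 2 ^- j :> R.
Proof. by rewrite invr_gt0 exprn_gt0. Qed.

Lemma exp2N_le1 (j : nat) : 2 ^- j <= 1 :> R.
Proof. by rewrite invf_le1 ?exprn_gt0// exprn_ege1// ler1n. Qed.

Lemma exp2NS (j : nat) : 2 ^- j.+1 = 2 ^- j / 2 :> R.
Proof. by rewrite exprS invfM mulrC. Qed.

Lemma windowP j t : window j t ->
  [/\ 9 / 16 <= cos t, 1 / 4 <= sin t & `|cos t - 2 * sin t| <= 2 ^- j].
Proof.
rewrite /window /= in_itv /= => /andP[t1 t2].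
have /near_theta0 : 0 <= t - theta0 <= 1 / 4.
  by have := exp2N_gt0 j.+1; have := exp2N_le1 j; lra.
rewrite subrKC => -[c s k]; split => //.
by apply: le_trans k _; lra.
Qed.

Lemma dx_dy n m m' : (m < 4 ^ n)%N -> (m' < 4 ^ n)%N ->
  2 * dx n m m' + dy n m m' = m'%:R - m%:R.
Proof.
move=> /xidx_yidx e /xidx_yidx e'.
by rewrite -[in RHS]e -[in RHS]e' /dx /dy 2!natrD 2!natrM; ring.
Qed.

(** The scale [k] is where the digits of [m] and [m'] separate, hence the same for all windows and
    directions. With [D = m' - m = 2 u + v], the projected difference is
    [u (cos t - 2 sin t) + D sin t]; being small, it forces [D] to be at most of order [|u| * 2^-j],
    while [|u|] is at most of order [4^k]. *)
Lemma close_level n m m' : (m + 8 <= m')%N -> (m' < 4 ^ n)%N ->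
  exists2 k, (k < n)%N & forall j t, window j t -> close_at n m m' t ->
    crosses (4 ^ k) (32 * 4 ^ k %/ 2 ^ j) m m' /\
    4 ^+ k / 24 <= `|dx n m m'|.
Proof.
move=> mm lt'; have lt : (m < 4 ^ n)%N by lia.
have [k [kn e ne]] : exists k, [/\ (k < n)%N,
    m %/ 4 ^ k.+1 = m' %/ 4 ^ k.+1 & m %/ 4 ^ k != m' %/ 4 ^ k]%N.
  by apply: separation_level => //; lia.
exists k => // j t /windowP[ct st kt] close.
have q0 : 0 < 4 ^+ k :> R by rewrite exprn_gt0.
have dup : 3 * `|dx n m m'| <= 4 * 4 ^+ k.
  have h1 := spread_same_block (leq 2) kn e.
  have h2 := spread_same_block (leq 2) kn (esym e).
  move: h1 h2; rewrite -/xidx -!(ltr_nat R) 2!natrD !natrX !natrM exprS => h1 h2.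
  have : `|dx n m m'| <= 4 * 4 ^+ k / 3 by rewrite ler_norml /dx; lra.
  by lra.
have dlow : 2 * 4 ^+ k <= 3 * `|dx n m m'| \/ 2 * 4 ^+ k <= 3 * `|dy n m m'|.
  have [f [fE]] := xidx_or_yidx_apart kn e ne.
  rewrite -!(ltr_nat R) 2!natrD !natrM natrX => h.
  have [h'|h'] : 2 * 4 ^+ k <= 3 * ((spread f n m')%:R - (spread f n m)%:R : R) \/
         2 * 4 ^+ k <= - (3 * ((spread f n m')%:R - (spread f n m)%:R : R)).
  - by case: h; [left|right]; lra.
  - case: fE => fE; subst f; [left|right];
      by rewrite (le_trans h')// ler_pM2l// ler_norm.
  - case: fE => fE; subst f; [left|right];
      by rewrite (le_trans h')// -mulrN ler_pM2l// -normrN ler_norm.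
have dxy := dx_dy lt lt'.
have mmR : 8 <= m'%:R - m%:R :> R.
  by move: mm; rewrite -(ler_nat R) natrD; lra.
set D : R := m'%:R - m%:R in dxy mmR *.
set u := dx n m m' in dup dlow dxy close *.
set v := dy n m m' in dlow dxy close *.
(* Since [D >= 8] and [sin t >= 1/4], [D sin t - 1] is at least [D / 8]. *)
have big : D / 8 <= `|u| * 2 ^- j.
  have : `|u * (cos t - 2 * sin t) + D * sin t| <= 1.
    by rewrite -dxy (_ : _ + _ = u * cos t + v * sin t)//; ring.
  rewrite ler_norml => /andP[_ cl].
  have cl2 := ler_norm (- (u * (cos t - 2 * sin t))); rewrite normrN in cl2.
  have : `|u * (cos t - 2 * sin t)| <= `|u| * 2 ^- j by rewrite normrM ler_wpM2l.
  nra.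
have j0 := exp2N_gt0 j; have j1 := exp2N_le1 j.
have u8 : D / 8 <= `|u| by have := normr_ge0 u; nra.
split; last first.
  case: dlow => [|dv]; first by lra.
  have : 3 * `|v| <= 3 * (D + 2 * `|u|).
    have -> : v = D - 2 * u by lra.
    rewrite ler_pM2l//; apply: le_trans (ler_normB _ _) _.
    by rewrite normrM normr_nat (ger0_norm (_ : 0 <= D)); lra.
  (* If [D <= 4^k / 3] then [|u| >= 4^k / 6]; otherwise [|u| >= D / 8 > 4^k / 24]. *)
  by have [|] := leP D (4 ^+ k / 3); lra.
have ltmm : (m < m')%N by rewrite (leq_trans _ mm)// -addn1 leq_add2l.
apply/and3P; split; [exact: ltmm| |exact: ne].
rewrite -leq_subLR leq_divRL ?expn_gt0// -(ler_nat R).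
have -> : (32 * 4 ^ k)%N%:R = 32 * 4 ^+ k :> R by rewrite natrM natrX.
rewrite natrM natrX natrB; last by rewrite (ltnW ltmm).
rewrite -/D -ler_pdivlMr ?exprn_gt0//.
have : `|u| * 2 ^- j <= 4 * 4 ^+ k / 3 * 2 ^- j by rewrite ler_pM2r//; lra.
have p : 0 < 4 ^+ k * 2 ^- j :> R by exact: mulr_gt0.
by move=> h; clear ltmm; lra.
Qed.

Lemma close_diam n m m' j t t' : window j t -> window j t' ->
  close_at n m m' t -> close_at n m m' t' ->
  `|dx n m m'| * `|t - t'| <= 4.
Proof.
rewrite /close_at /=; set u := dx n m m'; set v := dy n m m'.
move=> wt wt' ct ct'.
have tt : `|t - t'| <= 1.
  move: wt wt'; rewrite /window /= !in_itv /= => /andP[? ?] /andP[? ?].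
  by rewrite ler_norml; have := exp2N_le1 j; have := exp2N_gt0 j.+1; lra.
(* Combining the two closeness conditions eliminates [v]; then [|sin s| >= |s| / 2] for [|s| <= 1]
   converts the bound 2 into 4. *)
have e : u * sin (t' - t) = (u * cos t + v * sin t) * sin t'
   - (u * cos t' + v * sin t') * sin t by rewrite sinB; ring.
have h : `|u * sin (t' - t)| <= 2.
  rewrite e (le_trans (ler_normB _ _))// !normrM.
  have := sin_max t; have := sin_max t'.
  by move: ct ct'; have := normr_ge0 (sin t); have := normr_ge0 (sin t');
     nra.
rewrite distrC in tt *.
have := norm_sin_ge_half tt; move: h; rewrite normrM.
by have := normr_ge0 u; nra.
Qed.

End Pairs.

(** * Bounding the total measure of overlap by sums of explicit weights *)

Section Weights.
Context {R : realType}.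
Implicit Types t : R.
Local Notation mu := (@lebesgue_measure R).

Lemma measurable_close_at n m m' : measurable (@close_at R n m m').
Proof.
set f : R -> R := fun t => `|dx n m m' * cos t + dy n m m' * sin t|.
have mf : measurable_fun setT f.
  apply: continuous_measurable_fun => t; apply: cvg_norm.
  by apply: cvgD; apply: cvgM; [exact: cvg_cst|exact: continuous_cos|
    exact: cvg_cst|exact: continuous_sin].
have -> : close_at n m m' = setT `&` f @^-1` `]-oo, 1]%classic.
  by rewrite setTI; apply/seteqP; split => t; rewrite /close_at /= in_itv.
exact: mf.
Qed.

Lemma measurable_window j : measurable (@window R j).
Proof. exact: measurable_itv. Qed.

Lemma window_measure j : mu (window j) = (2 ^- j / 8)%:E.
Proof.
rewrite /window lebesgue_measure_itv /= lte_fin exp2NS.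
have j0 := @exp2N_gt0 R j.
by rewrite ifT -?EFinB; [congr EFin|]; lra.
Qed.

Lemma measure_diam_le (A : set R) (d : R) : measurable A -> 0 <= d ->
  (forall s t, A s -> A t -> `|s - t| <= d) -> (mu A <= (2 * d)%:E)%E.
Proof.
move=> mA d0 diam; have [->|/set0P[s As]] := eqVneq A set0.
  by rewrite measure0 lee_fin; lra.
apply: (@le_trans _ _ (mu `[s - d, s + d]%classic)).
  apply: le_measure; rewrite ?inE// => t At /=; rewrite in_itv /=.
  by have := diam _ _ As At; rewrite ler_norml; lra.
rewrite lebesgue_measure_itv /= lte_fin; case: ifPn => _; last first.
  by rewrite lee_fin; lra.
by rewrite -EFinB lee_fin; lra.
Qed.

Lemma close_atC n m m' : @close_at R n m m' = close_at n m' m.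
Proof.
apply/seteqP; split=> t; rewrite /close_at /= /dx /dy => h;
  by rewrite -normrN (le_trans _ h)// le_eqVlt; apply/orP; left;
     apply/eqP; congr `|_|; ring.
Qed.

(** Bounds the measure of close directions for a pair [m + 8 <= m']. The diameter is at most
    [4 / (4^k / 24) = 96 / 4^k], and the measure at most twice that. Summing over all [k] removes
    the dependence of the scale on the pair. *)
Definition crossing_weight n j m m' : R :=
  \sum_(k < n) 192 / 4 ^+ k * (crosses (4 ^ k) (32 * 4 ^ k %/ 2 ^ j) m m')%:R.

(** Both orders of a distant pair are covered; pairs with indices at distance at most 7 are charged
    more than the whole window. *)
Definition weight n j m m' : R :=
  crossing_weight n j m m' + crossing_weight n j m' m
  + 2 ^- j * (m - 7 <= m' < m + 8)%N%:R.

Lemma crossing_weight_ge0 n j m m' : 0 <= crossing_weight n j m m'.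
Proof. by apply: sumr_ge0 => k _; rewrite !mulr_ge0// invr_ge0 exprn_ge0. Qed.

Lemma far_measure n j m m' : (m + 8 <= m')%N -> (m' < 4 ^ n)%N ->
  (mu (close_at n m m' `&` window j) <= (crossing_weight n j m m')%:E)%E.
Proof.
move=> mm lt; have [k kn H] := @close_level R n m m' mm lt.
have [->|/set0P[s [cs ws]]] := eqVneq (@close_at R n m m' `&` @window R j) set0.
  by rewrite measure0 lee_fin crossing_weight_ge0.
have [cr dxk] := H j s ws cs.
have q0 : 0 < 4 ^+ k :> R by rewrite exprn_gt0.
apply: (@le_trans _ _ (2 * (96 / 4 ^+ k))%:E).
  apply: measure_diam_le.
  - by apply: measurableI; [exact: measurable_close_at|exact: measurable_window].
  - by rewrite divr_ge0// ltW.
  move=> x y [cx wx] [cy wy]; have h := close_diam wx wy cx cy.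
  rewrite ler_pdivlMr//.
  have : (4 ^+ k / 24) * `|x - y| <= 4 by rewrite (le_trans _ h)// ler_wpM2r.
  by lra.
rewrite lee_fin /crossing_weight (bigD1 (Ordinal kn)) //= cr mulr1.
rewrite (_ : 2 * _ = 192 / 4 ^+ k) ?lerDl ?sumr_ge0//; last lra.
Qed.

Lemma close_measure n j m m' : (m < 4 ^ n)%N -> (m' < 4 ^ n)%N ->
  (mu (close_at n m m' `&` window j) <= (weight n j m m')%:E)%E.
Proof.
move=> lt lt'; rewrite /weight.
have h1 := crossing_weight_ge0 n j m m'; have h2 := crossing_weight_ge0 n j m' m.
have h3 : 0 <= 2 ^- j * (m - 7 <= m' < m + 8)%N%:R :> R.
  by rewrite mulr_ge0// ltW// exp2N_gt0.
have [mm|m8] := leqP (m + 8) m'.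
  by apply: le_trans (far_measure j mm lt') _; rewrite lee_fin -addrA lerDl addr_ge0.
have [mm|m8'] := leqP (m' + 8) m.
  rewrite close_atC; apply: le_trans (far_measure j mm lt) _.
  by rewrite lee_fin -addrA addrCA lerDl addr_ge0.
apply: (@le_trans _ _ (mu (window j))).
  apply: le_measure; rewrite ?inE; [|exact: measurable_window|exact: subIsetr].
  by apply: measurableI; [exact: measurable_close_at|exact: measurable_window].
rewrite window_measure lee_fin (_ : (m - 7 <= m')%N = true); last lia.
by have := @exp2N_gt0 R j; rewrite mulr1; lra.
Qed.

(** Every scale contributes the same amount: [4^(n-k)] blocks, [r^2] pairs in each with
    [r <= 32 * 4^k / 2^j], and a factor [192 / 4^k]. *)
Lemma sum_crossing_weight n j :
  \sum_(m < 4 ^ n) \sum_(m' < 4 ^ n) crossing_weight n j m m'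
    <= (192 * 32 * 32) * 4 ^+ n * n%:R / 4 ^+ j.
Proof.
rewrite /crossing_weight.
under eq_bigr do rewrite exchange_big.
rewrite exchange_big /=.
rewrite (_ : (192 * 32 * 32) * _ * _ / _ =
  \sum_(k < n) (192 * 32 * 32) * 4 ^+ n / 4 ^+ j); last first.
  by rewrite sumr_const card_ord -[RHS]mulr_natr; ring.
apply: ler_sum => k _.
under eq_bigr do rewrite -mulr_sumr -natr_sum.
rewrite -mulr_sumr -natr_sum.
set r := (32 * 4 ^ k %/ 2 ^ j)%N.
have kn : (k <= n)%N by apply/ltnW/ltn_ord.
have := @sum_crosses_le (4 ^ k) r (4 ^ (n - k)) (expn_gt0 4 k).
rewrite -expnD subnK// -(ler_nat R) !natrM natrX => h.
have rle : r%:R <= 32 * 4 ^+ k * 2 ^- j :> R.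
  rewrite ler_pdivlMr ?exprn_gt0// -!natrX -!natrM ler_nat.
  exact: leq_trunc_div.
have q0 : 0 < 4 ^+ k :> R by rewrite exprn_gt0.
have := ler_pM (ler0n R r) (ler0n R r) rle rle => rr.
have nk0 : 0 <= 4 ^+ (n - k) :> R by rewrite exprn_ge0.
apply: (@le_trans _ _ (192 / 4 ^+ k *
  (4 ^+ (n - k) * (32 * 4 ^+ k * 2 ^- j * (32 * 4 ^+ k * 2 ^- j))))).
  rewrite ler_wpM2l ?divr_ge0 ?(ltW q0)//.
  by rewrite (le_trans h)// -mulrA ler_wpM2l.
rewrite le_eqVlt; apply/orP; left; apply/eqP.
rewrite -[in RHS](subnK kn) exprD.
have -> : 4 ^+ j = 2 ^+ j * 2 ^+ j :> R by rewrite -exprMn -natrM.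
have j0 : 2 ^+ j != 0 :> R by rewrite expf_neq0.
by field; rewrite j0 gt_eqF.
Qed.

(** The near-diagonal pairs cost at most [16 * 4^n * 2^-j], and [2^j <= n] gives [2^-j <= n / 4^j],
    so the crossing pairs absorb them. *)
Lemma sum_weight n j : (2 ^ j <= n)%N ->
  \sum_(m < 4 ^ n) \sum_(m' < 4 ^ n) weight n j m m'
    <= (400 * 32 * 32) * 4 ^+ n * n%:R / 4 ^+ j.
Proof.
move=> jn.
rewrite /weight; under eq_bigr do rewrite !big_split /=.
rewrite !big_split /= [X in _ + X + _]exchange_big /=.
have h1 := sum_crossing_weight n j.
have h2 : \sum_(m < 4 ^ n) \sum_(m' < 4 ^ n)
    2 ^- j * (m - 7 <= m' < m + 8)%N%:R <= 16 * 4 ^+ n * n%:R / 4 ^+ j :> R.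
  apply: (@le_trans _ _ (\sum_(m < 4 ^ n) 16 * 2 ^- j)).
    apply: ler_sum => m _; rewrite -mulr_sumr -natr_sum mulrC ler_pM2r ?exp2N_gt0//.
    by rewrite ler_nat (leq_trans (sum_interval_le _ _ _))//; lia.
  rewrite sumr_const card_ord -[_ *+ _]mulr_natr natrX.
  have jn' : 2 ^+ j <= n%:R :> R by rewrite -natrX ler_nat.
  have -> : 4 ^+ j = 2 ^+ j * 2 ^+ j :> R by rewrite -exprMn -natrM.
  have : 2 ^- j <= n%:R / (2 ^+ j * 2 ^+ j) :> R.
    rewrite ler_pdivlMr ?mulr_gt0 ?exprn_gt0// mulKf//.
  have : 0 < 4 ^+ n :> R by rewrite exprn_gt0.
  by nra.
have h3 : 0 <= 4 ^+ n * n%:R / 4 ^+ j :> R.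
  by rewrite divr_ge0 ?mulr_ge0 ?exprn_ge0.
by lra.
Qed.

End Weights.

(** * Second moments *)

Section Measure.
Context {d : measure_display} {T : measurableType d} {R : realType}.
Variable mu : {measure set T -> \bar R}.

(* No measurability of g is needed, the integral being a supremum over simple
   functions; T is arbitrary in theta, so the projected length may fail to be
   measurable in theta. *)
Lemma nonneg_integral_mono (D : set T) (f g : T -> \bar R) :
  (forall x, D x -> 0 <= f x)%E -> (forall x, D x -> f x <= g x)%E ->
  (\int[mu]_(x in D) f x <= \int[mu]_(x in D) g x)%E.
Proof.
move=> f0 fg; rewrite !ge0_integralE//; last first.
  by move=> x Dx; apply: le_trans (fg x Dx); exact: f0.
apply: le_ereal_sup => _ [h hf <-]; exists h => // x.
apply: le_trans (hf x) _; rewrite !patchE; case: ifPn => //.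
by rewrite inE; exact: fg.
Qed.

Lemma measurable_sum_indic (I : finType) (c : I -> R) (A : I -> set T) (D : set T) :
  (forall i, measurable (A i)) ->
  measurable_fun D (fun x => \sum_i c i * \1_(A i) x).
Proof.
move=> mA; apply: measurable_sum => i.
apply: measurable_funM; first exact: measurable_cst.
exact: measurable_indic.
Qed.

Lemma integral_sum_indic (I : finType) (c : I -> R) (A : I -> set T) (D : set T) :
  measurable D -> (forall i, 0 <= c i) -> (forall i, measurable (A i)) ->
  (\int[mu]_(x in D) (\sum_i c i * \1_(A i) x)%:E =
   \sum_i (c i)%:E * mu (A i `&` D))%E.
Proof.
move=> mD c0 mA.
under eq_integral do rewrite -sumEFin.
have mi i : measurable_fun D (fun x => (\1_(A i) x)%:E : \bar R).
  by apply/measurable_EFinP; exact: measurable_indic.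
rewrite ge0_integral_sum//.
- apply: eq_bigr => i _.
  under eq_integral do rewrite EFinM.
  by rewrite ge0_integralZl ?integral_indic ?lee_fin// => x _; rewrite lee_fin.
- move=> i; apply/measurable_EFinP; apply: measurable_funM;
    [exact: measurable_cst|exact: measurable_indic].
- by move=> i x _; rewrite lee_fin mulr_ge0.
Qed.

(* Integrates 1_U >= 2 s / l - s^2 / l^2, where s counts the A i containing a point. *)
Lemma second_moment (I : finType) (A : I -> set T) (l : R) : 0 < l ->
  (forall i, measurable (A i)) ->
  (\sum_i (2 / l)%:E * mu (A i) <=
   mu (\bigcup_i A i) + \sum_i \sum_j (l ^- 2)%:E * mu (A i `&` A j))%E.
Proof.
move=> l0 mA; set U := \bigcup_i A i.
have mU : measurable U.
  by apply: fin_bigcup_measurable => //; exact: finite_finset.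
have l2 : 0 <= l ^- 2 by rewrite invr_ge0 exprn_ge0// ltW.
have l2' : 0 <= 2 / l by rewrite divr_ge0// ltW.
pose B (p : I * I) := A p.1 `&` A p.2.
have mB p : measurable (B p) by exact: measurableI.
have intT (K : finType) (C : K -> set T) (a : R) : 0 <= a ->
    (forall k, measurable (C k)) ->
    (\sum_k a%:E * mu (C k) = \int[mu]_x (\sum_k a * \1_(C k) x)%:E)%E.
  by move=> a0 mC; rewrite integral_sum_indic//; apply: eq_bigr => k _; rewrite setIT.
rewrite pair_big /= (intT _ A)// (intT _ B)//.
have mind : measurable_fun setT (fun x => (\1_U x : R)%:E).
  by apply/measurable_EFinP; exact: measurable_indic.
have msum : measurable_fun setT (fun x => (\sum_k l ^- 2 * \1_(B k) x)%:E).
  by apply/measurable_EFinP; exact: measurable_sum_indic.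
have sum0 x : (0 <= (\sum_k l ^- 2 * \1_(B k) x)%:E)%E.
  by rewrite lee_fin sumr_ge0// => i _; rewrite mulr_ge0.
have ind0 x : (0 <= (\1_U x : R)%:E)%E by rewrite lee_fin.
rewrite -[U]setIT -integral_indic// -ge0_integralD//.
apply: nonneg_integral_mono => x _.
  by rewrite lee_fin sumr_ge0// => i _; rewrite mulr_ge0.
rewrite -EFinD lee_fin -!mulr_sumr.
set s := \sum_i \1_(A i) x.
have -> : \sum_p \1_(B p) x = s * s.
  rewrite /s mulr_suml; under [RHS]eq_bigr do rewrite mulr_sumr.
  by rewrite pair_big; apply: eq_bigr => p _; rewrite /B indicI.
have [Ux|Ux] := boolP (x \in U).
  rewrite indicE Ux /=.
  have -> : l ^- 2 * (s * s) = (s / l) ^+ 2 by field; rewrite gt_eqF.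
  have := sqr_ge0 (1 - s / l); nra.
have -> : s = 0.
  apply: big1 => i _; rewrite indicE (_ : _ \in _ = false)//.
  apply: contraNF Ux; rewrite !inE => Ax; by exists i.
by rewrite !mulr0 addr0.
Qed.

End Measure.

(* lebesgue_measure is the outer measure on non-measurable sets. *)
Lemma le_lebesgue_measure {R : realType} (A B : set R) : A `<=` B ->
  (lebesgue_measure A <= lebesgue_measure B)%E.
Proof.
exact: (@le_outer_measure _ _ (mu_ext (@wlength R idfun))).
Qed.

(** * Perturbed projections of the squares *)

Section Geometry.
Context {R : realType}.
Local Notation mu := (@lebesgue_measure R).

Lemma exp4N_gt0 (n : nat) : 0 < 4 ^- n :> R.
Proof. by rewrite invr_gt0 exprn_gt0. Qed.

Lemma exp4NS (n : nat) : 4 ^- n.+1 = 4 ^- n / 4 :> R.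
Proof. by rewrite exprS invfM mulrC. Qed.

Lemma spread_cantor_lefts f n m :
  3 * 4 ^- n * (spread f n m)%:R \in @cantor_lefts R n.
Proof.
elim: n m => [|n IHn] m; first by rewrite /= mulr0 inE.
have e : (4 * spread f n (m %/ 4)%N + f (m %% 4)%N)%N%:R
    = 4 * (spread f n (m %/ 4)%N)%:R + (f (m %% 4)%N)%:R :> R.
  by rewrite natrD natrM.
apply/flatten_mapP; exists (3 * 4 ^- n * (spread f n (m %/ 4)%N)%:R) => //.
rewrite [spread _ _ _]/= e exp4NS !inE; case: (f _) => /=.
  by apply/orP; right; apply/eqP; field; rewrite expf_neq0.
by apply/orP; left; apply/eqP; field; rewrite expf_neq0.
Qed.

Definition corner n m : pt R :=
  (3 * 4 ^- n * (xidx n m)%:R, 3 * 4 ^- n * (yidx n m)%:R).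

Lemma corner_cantorK n m (x : R) : 0 <= x <= 4 ^- n ->
  cantorK n ((corner n m).1 + x, (corner n m).2).
Proof.
move=> /andP[x0 x1]; have n0 := exp4N_gt0 n.
split; [exists (corner n m).1 | exists (corner n m).2];
  by split; [exact: spread_cantor_lefts | rewrite /=; lra].
Qed.

Lemma spread_coord_le1 f n m : 3 * 4 ^- n * (spread f n m)%:R <= 1 :> R.
Proof.
have [_] := spread_block f 0 n m; rewrite add0n /= muln0 muln0 add0n.
rewrite -(ltr_nat R) natrM natrX => h.
by rewrite mulrAC ler_pdivrMr ?exprn_gt0// mul1r ltW.
Qed.

Lemma dist2_corner n m m' : dist2 (corner n m) (corner n m') <= 2.
Proof.
rewrite /dist2 /=.
have h f k : 0 <= (3 * 4 ^- n * (spread f n k)%:R : R) <= 1.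
  by rewrite spread_coord_le1 !mulr_ge0// ltW// exp4N_gt0.
have hx := h (leq 2) m; have hy := h odd m.
have hx' := h (leq 2) m'; have hy' := h odd m'.
rewrite -/xidx -/yidx in hx hy hx' hy'.
rewrite -(@ler_pXn2r _ 2) ?nnegrE ?sqrtr_ge0// sqr_sqrtr; last first.
  by rewrite addr_ge0 ?sqr_ge0.
nra.
Qed.

Lemma trig_cauchy_schwarz (a b t : R) :
  `|a * cos t + b * sin t| <= Num.sqrt (a ^+ 2 + b ^+ 2).
Proof.
rewrite -sqrtr_sqr ler_sqrt ?addr_ge0 ?sqr_ge0//.
have := cos2Dsin2 t; have := sqr_ge0 (a * sin t - b * cos t).
set c := cos t; set s := sin t => h e.
suff -> : a ^+ 2 + b ^+ 2 = (a * c + b * s) ^+ 2 + (a * s - b * c) ^+ 2 by lra.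
by rewrite -[LHS]mulr1 -e; ring.
Qed.

Definition height (f : pt R -> pt R) t (z : pt R) : R :=
  (f z).1 * cos t + (f z).2 * sin t.

(** The quantity on the left is the projection of the increment of [f - Id], and projection does not
    increase length. *)
Lemma height_dev f L t (z w : pt R) :
  (forall z w, dist2 (minus_id f z) (minus_id f w) <= L * dist2 z w) ->
  `|height f t z - height f t w - ((z.1 - w.1) * cos t + (z.2 - w.2) * sin t)|
    <= L * dist2 z w.
Proof.
move=> fL; apply: le_trans (fL z w); rewrite /dist2 /=.
set a := (X in Num.sqrt (X ^+ 2 + _)); set b := (X in Num.sqrt (_ + X ^+ 2)).
apply: le_trans (trig_cauchy_schwarz a b t).
rewrite le_eqVlt; apply/orP; left; apply/eqP; congr `|_|.
by rewrite /a /b /height; ring.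
Qed.

(** An interval standing in for the projected image of square [m]: its length does not depend on the
    perturbation, and it is measurable. *)
Definition shadow (f : pt R -> pt R) t n m : set R :=
  `[height f t (corner n m), height f t (corner n m) + 4 ^- n / 2]%classic.

(** Along the bottom side of the square the height is continuous and rises by at least
    [4^-n * (9/16 - 1/16)], as [n >= 2] makes the Lipschitz constant at most 1/16. The intermediate
    value theorem fills the interval. *)
Lemma shadow_sub_proj f t n m : (2 <= n)%N -> lip_lt (minus_id f) (4 ^- n) ->
  9 / 16 <= cos t -> shadow f t n m `<=` Defs.proj t (f @` cantorK n).
Proof.
move=> n2 [L [Llt fL]] ct.
have n0 := exp4N_gt0 n.
have n16 : 4 ^- n <= 1 / 16 :> R.
  rewrite -(subnK n2) exprD invfM -[X in _ <= X]mul1r ler_pM ?invr_ge0 ?exprn_ge0//.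
    by rewrite invf_le1 ?exprn_gt0// exprn_ege1// ler1n.
  by rewrite div1r lef_pV2 ?posrE// ?exprn_gt0// -natrX.
pose z (x : R) : pt R := ((corner n m).1 + x, (corner n m).2).
pose phi x := height f t (z x).
have dz x y : dist2 (z x) (z y) = `|x - y|.
  by rewrite /dist2 /z /= subrr expr0n addr0 sqrtr_sqr; congr `|_|; ring.
have dev x y : `|phi x - phi y - (x - y) * cos t| <= 4 ^- n * `|x - y|.
  have := height_dev t (z x) (z y) fL; rewrite dz => h.
  have -> : (x - y) * cos t = ((z x).1 - (z y).1) * cos t + ((z x).2 - (z y).2) * sin t.
    by rewrite /z /=; ring.
  by apply: le_trans h _; rewrite ler_wpM2r// ltW.
have cont : continuous phi.
  move=> x; apply/cvgrPdist_lt => e e0; near=> y.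
  have : `|x - y| < e / 2.
    near: y; apply: cvgr_dist_lt; last by rewrite divr_gt0.
    exact: cvg_id.
  have := dev x y; have := ler_norm (x - y); have := ler_norm (- (x - y)).
  rewrite normrN; have := cos_le1 t.
  set r := `|x - y|; rewrite ler_norml => h1 h2 h3 /andP[h4 h5] h6.
  rewrite ltr_norml; nra.
move=> v; rewrite /shadow /= in_itv /= => /andP[v1 v2].
have z0 : z 0 = corner n m by rewrite /z addr0; case: (corner n m).
have phi0 : phi 0 = height f t (corner n m) by rewrite /phi z0.
have phi1 : phi 0 + 4 ^- n / 2 <= phi (4 ^- n).
  have := dev (4 ^- n) 0; rewrite subr0 (ger0_norm (ltW n0)) ler_norml => /andP[h _].
  nra.
have [c] : exists2 c, c \in `[0, 4 ^- n] & phi c = v.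
  apply: IVT; [exact: ltW|exact: continuous_subspaceT|].
  rewrite ge_min le_max phi0 v1 /=; apply/orP; right.
  by apply: le_trans phi1; rewrite phi0.
rewrite in_itv /= => c01 <-.
exists (f (z c)); last by [].
by exists (z c) => //; exact: corner_cantorK.
Unshelve. all: by end_near.
Qed.

(** Overlap puts the two heights within [4^-n / 2]. Corners are at distance at most 2, so the
    perturbation adds at most [2 * 4^-n], and the total stays below [3 * 4^-n]. *)
Lemma shadow_overlap f t n m m' : lip_lt (minus_id f) (4 ^- n) ->
  shadow f t n m `&` shadow f t n m' !=set0 -> close_at n m m' t.
Proof.
move=> [L [Llt fL]] [v []]; rewrite /shadow /= !in_itv /= => /andP[a1 a2] /andP[b1 b2].
have n0 := exp4N_gt0 n.
have := height_dev t (corner n m') (corner n m) fL.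
have d0 : 0 <= dist2 (corner n m') (corner n m) by rewrite sqrtr_ge0.
have d2 := dist2_corner n m' m.
rewrite [X in `|_ - X|](_ : _ = 3 * 4 ^- n * (dx n m m' * cos t + dy n m m' * sin t)); last first.
  by rewrite /corner /dx /dy /=; ring.
rewrite /close_at /=; set D := dx _ _ _ * _ + _.
rewrite ler_norml => /andP[h1 h2].
have h3 : L * dist2 (corner n m') (corner n m) <= 4 ^- n * 2.
  apply: le_trans (_ : 4 ^- n * dist2 (corner n m') (corner n m) <= _).
    by rewrite ler_wpM2r// ltW.
  by rewrite ler_wpM2l// ltW.
have : `|4 ^- n * D| <= 4 ^- n * 1 by rewrite ler_norml; lra.
by rewrite normrM (ger0_norm (ltW n0)) ler_pM2l.
Qed.

Lemma shadow_measure f t n m : mu (shadow f t n m) = (4 ^- n / 2)%:E.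
Proof.
rewrite /shadow lebesgue_measure_itv /= lte_fin; have n0 := exp4N_gt0 n.
by rewrite ifT -?EFinB; [congr EFin|]; lra.
Qed.

(** [second_moment] applied to the [4^n] shadows: their lengths add up to 1/2, and a pair meets in
    length at most [4^-n / 2], and only when it is close. *)
Lemma proj_lower_bound f t n l : (2 <= n)%N -> lip_lt (minus_id f) (4 ^- n) ->
  9 / 16 <= cos t -> 0 < l ->
  (l^-1%:E <= mu (Defs.proj t (f @` cantorK n)) +
    (\sum_(p : 'I_(4 ^ n) * 'I_(4 ^ n))
       (2 * l ^+ 2 * 4 ^+ n)^-1 * \1_(close_at n p.1 p.2) t)%:E)%E.
Proof.
move=> n2 lip ct l0.
have n0 := exp4N_gt0 n.
have mS m : measurable (shadow f t n m) by exact: measurable_itv.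
have := @second_moment _ _ _ mu 'I_(4 ^ n) (fun m => shadow f t n m) l l0 (fun=> mS _).
have -> : (\sum_(i < 4 ^ n) (2 / l)%:E * mu (shadow f t n i) = l^-1%:E)%E.
  under eq_bigr do rewrite shadow_measure -EFinM.
  rewrite sumEFin sumr_const card_ord; congr EFin; rewrite -[LHS]mulr_natr natrX.
  by field; rewrite gt_eqF//= expf_neq0.
move=> h; apply: (le_trans h); apply: leeD.
  by apply: le_lebesgue_measure => x [m _]; exact: shadow_sub_proj.
rewrite pair_big /= -sumEFin; apply: lee_sum => -[m m'] _ /=.
have -> : (2 * l ^+ 2 * 4 ^+ n)^-1 * \1_(close_at n m m') t =
   l ^- 2 * (4 ^- n / 2 * \1_(close_at n m m') t).
  by field; rewrite ?expf_neq0 ?gt_eqF //=.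
rewrite EFinM lee_pmul2l ?lte_fin ?invr_gt0 ?exprn_gt0//.
have [e|/set0P ne] := eqVneq (shadow f t n m `&` shadow f t n m') set0.
  by rewrite e measure0 lee_fin !mulr_ge0// ltW.
rewrite indicE mem_set ?mulr1; last exact: shadow_overlap ne.
rewrite -(shadow_measure f t n m).
by apply: le_lebesgue_measure; exact: subIsetl.
Qed.

End Geometry.

(** * Averaging over the windows *)

Section Averaging.
Context {R : realType}.
Local Notation mu := (@lebesgue_measure R).

Variable c : R.
Hypothesis c_gt0 : 0 < c.
Hypothesis c_bound : forall n j, (2 ^ j <= n)%N ->
  \sum_(m < 4 ^ n) \sum_(m' < 4 ^ n) weight n j m m' <= c * 4 ^+ n * n%:R / 4 ^+ j.

(* The typical multiplicity of the projection over window j. *)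
Definition level n j : R := 8 * c * n%:R * 2 ^- j.

Definition pair_coef n j : R := (2 * level n j ^+ 2 * 4 ^+ n)^-1.

(** A measurable lower bound for the projected length on window [j]. The positive part keeps it
    nonnegative where the overlap count is large. *)
Definition minorant n j (t : R) : R :=
  \1_(window j) t * Num.max 0 ((level n j)^-1 -
    \sum_(p : 'I_(4 ^ n) * 'I_(4 ^ n)) pair_coef n j * \1_(close_at n p.1 p.2) t).

Lemma minorant_ge0 n j t : 0 <= minorant n j t.
Proof. by rewrite mulr_ge0// le_max lexx. Qed.

Lemma measurable_minorant n j (D : set R) : measurable_fun D (minorant n j).
Proof.
apply: measurable_funM; first by apply: measurable_indic; exact: measurable_window.
apply: measurable_maxr; first exact: measurable_cst.
apply: measurable_funB; first exact: measurable_cst.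
by apply: measurable_sum_indic => p; exact: measurable_close_at.
Qed.

Lemma level_gt0 n j : (0 < n)%N -> 0 < level n j.
Proof.
by move=> n0; rewrite /level mulr_gt0 ?exp2N_gt0// mulr_gt0 ?ltr0n// mulr_gt0.
Qed.

Lemma window_sub j : @window R j `<=` `[0, 2 * pi]%classic.
Proof.
move=> t; rewrite /window /= !in_itv /= => /andP[t1 t2].
have := @theta0_itv R; have := @pi_ge2 R.
have := @exp2N_gt0 R j.+1; have := @exp2N_le1 R j; lra.
Qed.

(** The main term integrates to [(2^-j / 8) / level = 1 / (64 c n)]. The factor 8 in [level] makes
    the pair term at most half of this. *)
Lemma integral_minorant n j : (0 < n)%N -> (2 ^ j <= n)%N ->
  (((128 * c * n%:R)^-1)%:E <=
    \int[mu]_(t in `[0%R, (2 * pi)%R]%classic) (minorant n j t)%:E)%E.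
Proof.
move=> n0 jn; set D := `[0, 2 * pi]%classic.
have mD : measurable D by exact: measurable_itv.
have l0 := level_gt0 j n0; have nR : 0 < n%:R :> R by rewrite ltr0n.
have j0 := @exp2N_gt0 R j.
have a0 : 0 <= pair_coef n j.
  by rewrite invr_ge0 mulr_ge0 ?exprn_ge0// mulr_ge0// sqr_ge0.
pose B (p : 'I_(4 ^ n) * 'I_(4 ^ n)) := @close_at R n p.1 p.2 `&` window j.
have mB p : measurable (B p).
  by apply: measurableI; [exact: measurable_close_at|exact: measurable_window].
have BD p : B p `&` D = B p.
  by apply/setIidPl; apply: subset_trans (@window_sub j); exact: subIsetr.
pose G t := \sum_p pair_coef n j * \1_(B p) t.
have c0 : c != 0 by rewrite gt_eqF.
have e4 : 4 ^+ j = 2 ^+ j * 2 ^+ j :> R by rewrite -exprMn -natrM.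
have e2 : 2 ^+ j != 0 :> R by rewrite expf_neq0.
have en : 4 ^+ n != 0 :> R by rewrite expf_neq0.
have intG : (\int[mu]_(t in D) (G t)%:E <= ((128 * c * n%:R)^-1)%:E)%E.
  rewrite integral_sum_indic//.
  apply: (@le_trans _ _ (\sum_(p : 'I_(4 ^ n) * 'I_(4 ^ n))
      (pair_coef n j * weight n j p.1 p.2)%:E)%E).
    apply: lee_sum => p _; rewrite EFinM BD lee_wpmul2l ?lee_fin//.
    exact: close_measure.
  rewrite sumEFin lee_fin -mulr_sumr.
  rewrite -(pair_big xpredT xpredT (fun m m' : 'I_(4 ^ n) => weight n j m m')) /=.
  apply: le_trans (ler_wpM2l a0 (c_bound jn)) _.
  rewrite le_eqVlt; apply/orP; left; apply/eqP.
  by rewrite /pair_coef /level e4; field; rewrite c0 e2 en gt_eqF.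
have mmin : measurable_fun D (fun t => (minorant n j t)%:E).
  by apply/measurable_EFinP; exact: measurable_minorant.
have mG : measurable_fun D (fun t => (G t)%:E).
  by apply/measurable_EFinP; exact: measurable_sum_indic.
have min0 t : D t -> (0 <= (minorant n j t)%:E)%E by rewrite lee_fin minorant_ge0.
have G0 t : (0 <= (G t)%:E)%E.
  by rewrite lee_fin sumr_ge0// => p _; rewrite mulr_ge0.
(* The pair term is moved to the right, so that only nonnegative functions are integrated. *)
have : (\int[mu]_(t in D) ((level n j)^-1 * \1_(window j) t)%:E <=
    \int[mu]_(t in D) ((minorant n j t)%:E + (G t)%:E))%E.
  apply: nonneg_integral_mono => t _.
    by rewrite lee_fin mulr_ge0// invr_ge0 ltW.
  rewrite -EFinD lee_fin /minorant /G.
  have [wt|wt] := boolP (t \in window j); last first.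
    by rewrite indicE (negbTE wt) mulr0 mul0r add0r -lee_fin G0.
  rewrite indicE wt mul1r mulr1 -lerBlDr le_max; apply/orP; right.
  rewrite le_eqVlt; apply/orP; left; apply/eqP; congr (_ - _).
  apply: eq_bigr => p _; congr (_ * _).
  by rewrite /B indicI /= [X in _ * X]indicE wt mulr1.
have -> : (\int[mu]_(t in D) ((level n j)^-1 * \1_(window j) t)%:E =
    ((64 * c * n%:R)^-1)%:E)%E.
  under eq_integral do rewrite EFinM.
  rewrite ge0_integralZl//.
  - rewrite integral_indic//; last exact: measurable_window.
    have -> : window j `&` D = window j by apply/setIidPl; exact: window_sub.
    rewrite [X in (_ * X)%E](window_measure j).
    rewrite -EFinM; congr EFin.
    by rewrite /level; field; rewrite c0 e2 gt_eqF.
  - by apply/measurable_EFinP; apply: measurable_indic; exact: measurable_window.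
  - by rewrite lee_fin invr_ge0 ltW.
rewrite ge0_integralD// => h.
have {h} := le_trans h (leeD2l _ intG).
rewrite -leeBlDr// -EFinB; apply: le_trans; rewrite lee_fin.
rewrite le_eqVlt; apply/orP; left; apply/eqP.
by field; rewrite c0 gt_eqF.
Qed.

Lemma window_disjoint i j t : @window R i t -> window j t -> i = j.
Proof.
wlog ij : i j / (i <= j)%N.
  by move=> H wi wj; have [/H->|/ltnW/H->] := leqP i j.
rewrite /window /= !in_itv /= => /andP[i1 i2] /andP[j1 j2].
apply/eqP; rewrite eqn_leq ij leqNgt; apply/negP => {}ij.
have : 2 ^- j <= 2 ^- i.+1 :> R by rewrite lef_pV2 ?posrE ?exprn_gt0// ler_eXn2l// ltr1n.
lra.
Qed.

(** The windows are disjoint, so at most one summand is nonzero at [t]; [proj_lower_bound] with [l]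
    the level of that window bounds it. *)
Lemma minorant_le_proj f t n J : (2 <= n)%N -> lip_lt (minus_id f) (4 ^- n) ->
  ((\sum_(j < J) minorant n j t)%:E <= mu (Defs.proj t (f @` cantorK n)))%E.
Proof.
move=> n2 lip.
have [/existsP[j /asboolP wj]|] := boolP [exists j : 'I_J, `[< window j t >]]; last first.
  rewrite negb_exists => /forallP nw; rewrite big1 ?measure_ge0// => j _.
  by rewrite /minorant indicE memNset ?mul0r//; apply/asboolPn; exact: nw.
rewrite (bigD1 j)//= big1 ?addr0; last first.
  move=> i ij; rewrite /minorant indicE memNset ?mul0r// => wi.
  by move: ij; rewrite -val_eqE /= (window_disjoint wi wj) eqxx.
have [ct _ _] := windowP wj.
rewrite /minorant indicE mem_set// mul1r EFin_max ge_max measure_ge0 /=.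
rewrite EFinB leeBlDr//.
by apply: proj_lower_bound => //; apply: level_gt0; lia.
Qed.

End Averaging.

(** * Summing over logarithmically many windows *)

Lemma ln_le_trunc_log {R : realType} n : (0 < n)%N ->
  ln n%:R <= (trunc_log 2 n).+1%:R :> R.
Proof.
move=> n0.
have h : n%:R <= 2 ^+ (trunc_log 2 n).+1 :> R.
  by rewrite -natrX ler_nat ltnW// trunc_log_ltn.
have : ln (n%:R : R) <= ln (2 ^+ (trunc_log 2 n).+1).
  by rewrite ler_ln ?posrE ?ltr0n// exprn_gt0.
move/le_trans; apply; rewrite lnXn// -[X in X <= _]mulr_natl ler_piMr//.
by have := @le_ln1Dx R 1; rewrite (_ : 1 + 1 = 2)//; apply; lra.
Qed.

Theorem theorem3 (R : realType) (T : nat -> pt R -> pt R -> pt R) :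
  (forall (n : nat) (theta : R), (1 <= n)%N ->
     lip_lt (minus_id (Tth (T n) theta)) (4 ^- n)) ->
  exists C : R, 0 < C /\
    forall n : nat, (2 <= n)%N ->
      ((C * ln n%:R / n%:R)%:E <= Fav (T n) (@cantorK R n))%E.
Proof.
move=> lipT.
have [c [c0 cb]] : exists c : R, 0 < c /\ forall n j, (2 ^ j <= n)%N ->
    \sum_(m < 4 ^ n) \sum_(m' < 4 ^ n) weight n j m m' <= c * 4 ^+ n * n%:R / 4 ^+ j.
  exists (400 * 32 * 32); split; [lra|exact: sum_weight].
have p0 := @pi_gt0 R.
(* The normalisation of [Fav] times the contribution [1 / (128 c n)] of one window, without its
   factor [1 / n]. *)
exists ((2 * pi)^-1 * (128 * c)^-1); split.
  by rewrite mulr_gt0 // invr_gt0 mulr_gt0.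
move=> n n2; have n0 : (0 < n)%N by exact: leq_trans n2.
have nR : 0 < n%:R :> R by rewrite ltr0n.
(* The indices [j < J] are exactly those with [2^j <= n], and [J >= ln n] because [ln 2 <= 1]. *)
set J := (trunc_log 2 n).+1.
apply: (@le_trans _ _ ((2 * pi)^-1%:E * (J%:R * (128 * c * n%:R)^-1)%:E)%E).
  rewrite -EFinM lee_fin -!mulrA ler_pM2l ?invr_gt0 ?mulr_gt0//.
  rewrite [X in _ <= X](_ : _ = (128 * c)^-1 * (J%:R / n%:R)); last first.
    by field; rewrite !gt_eqF.
  rewrite ler_pM2l ?invr_gt0 ?mulr_gt0// ler_pM2r ?invr_gt0//.
  exact: ln_le_trunc_log.
rewrite /Fav lee_pmul2l ?lte_fin ?invr_gt0 ?mulr_gt0//.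
apply: (@le_trans _ _ (\int[lebesgue_measure]_(t in `[0%R, (2 * pi)%R]%classic)
    (\sum_(j < J) minorant c n j t)%:E)%E); last first.
  apply: nonneg_integral_mono => t _.
    by rewrite lee_fin sumr_ge0// => j _; exact: minorant_ge0.
  by apply: minorant_le_proj => //; exact: lipT.
under eq_integral do rewrite -sumEFin.
rewrite ge0_integral_sum//; first last.
- by move=> j t _; rewrite lee_fin minorant_ge0.
- by move=> j; apply/measurable_EFinP; exact: measurable_minorant.
have -> : (J%:R * (128 * c * n%:R)^-1)%:E = (\sum_(j < J) (128 * c * n%:R)^-1%:E)%E.
  by rewrite sumEFin sumr_const card_ord mulr_natl.
apply: lee_sum => j _; apply: integral_minorant => //.
apply: leq_trans (trunc_logP (isT : (1 < 2)%N) n0).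
by rewrite leq_exp2l// -ltnS.
Qed.
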